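(* Let $m,n\ge1$ be integers. In the $(m+1)$-round classical bit commitment protocol described in the context, if Alice is honest then the protocol is hiding against classical Bob: for every classical strategy of dishonest Bob respecting the causal constraints, the joint distribution of everything Bob holds at the opening point (his shared randomness $R_B$ and Alice's messages $X_1,\dots,X_m$) is the same whether Alice commits to $d=0$ or to $d=1$.
   Context: All $n$-bit strings are identified with elements of the finite field $\mathbb{F}_{2^n}$; $\oplus$ is addition (bitwise XOR) and $*$ is multiplication in $\mathbb{F}_{2^n}$; for a bit $d$ and a string $y$, $d\cdot y$ equals $0$ if $d=0$ and $y$ if $d=1$. Protocol with honest Alice. Alice's secret strings $A_1,\dots,A_m$ are independent and uniformly distributed on $\mathbb{F}_{2^n}$ and independent of Bob's randomness $R_B$. In round $k$ ($1\le k\le m$; rounds alternate between two distant locations) Bob sends $Y_k\in\mathbb{F}_{2^n}$ and Alice replies with $$X_1=d\cdot Y_1\oplus A_1,\qquad X_k=(Y_k*A_{k-1})\oplus A_k\quad(2\le k\le m),$$ where $d\in\{0,1\}$ is the bit she commits to. The opening point is the moment after round $m$ and before Alice opens the commitment. Dishonest classical Bob. Consecutive rounds are space-like separated, so Bob's message in round $k$ may depend only on randomness $R_B$ shared in advance by his agents (a random variable with values in a finite set) and on Alice's replies in rounds $1,\dots,k-2$: a strategy consists of the distribution of $R_B$ and arbitrary deterministic functions $f_k$ with $$Y_k=f_k(R_B,X_1,\dots,X_{k-2})\qquad(1\le k\le m),$$ so that $Y_1,Y_2$ depend on $R_B$ only. *)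

(* Defs.v *)
From HB Require Import structures.
From mathcomp Require Import all_boot all_order all_algebra.
From mathcomp Require Import all_classical all_reals all_analysis.

Set Implicit Arguments.
Unset Strict Implicit.
Unset Printing Implicit Defensive.

Import Order.TTheory GRing.Theory Num.Theory.
Local Open Scope classical_set_scope.
Local Open Scope ring_scope.

Section Protocol.
Variables (F : finFieldType) (T : finType).

(* Rounds are numbered from 1, and [f k] is Bob's function in round [k]. Its
   last argument is the tuple (X_1, ..., X_(k-2)); subtraction is truncated,
   so that this tuple is empty in rounds 1 and 2. The value [f 0] is unused. *)
Definition strategy := forall k : nat, T -> (k - 2).-tuple F -> F.

(* [s] lists Alice's replies so far, with X_j stored at position j - 1; only
   X_1, ..., X_(k-2) are passed on to [f k]. *)
Definition message (f : strategy) (r : T) (k : nat) (s : seq F) : F :=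
  f k r [tuple s`_j | j < k - 2].

Definition dotb (d : bool) (y : F) : F := if d then y else 0.

(* The sequence X_1, ..., X_k when Alice commits to [d] with secret strings
   A_j = [a j], 1 <= j <= k, and Bob's shared randomness is [r]. *)
Fixpoint replies (f : strategy) (d : bool) (r : T) (a : nat -> F) (k : nat) :
    seq F :=
  if k is i.+1 then
    let s := replies f d r a i in
    let y := message f r i.+1 s in
    rcons s ((if i is 0 then dotb d y else y * a i) + a i.+1)
  else [::].

(* X_k *)
Definition alice f d r a (k : nat) : F := (replies f d r a k)`_(k.-1).

(* Y_k *)
Definition bob (f : strategy) d r a (k : nat) : F :=
  f k r [tuple alice f d r a j.+1 | j < k - 2].

(* (R_B, (X_1, ..., X_m)) *)
Definition view (f : strategy) (m : nat) (d : bool) (r : T) (a : nat -> F) :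
    T * m.-tuple F :=
  (r, [tuple alice f d r a i.+1 | i < m]).

Lemma size_replies f d r a k : size (replies f d r a k) = k.
Proof. by elim: k => //= k IH; rewrite size_rcons IH. Qed.

Lemma nth_replies f d r a k j :
  (j < k)%N -> (replies f d r a k)`_j = alice f d r a j.+1.
Proof.
elim: k => // k IH; rewrite ltnS leq_eqVlt => /orP[/eqP -> //|jk].
by rewrite /= nth_rcons size_replies jk IH.
Qed.

Lemma message_replies f d r a k :
  message f r k (replies f d r a k.-1) = bob f d r a k.
Proof.
rewrite /message /bob; congr (f k r _); apply: eq_from_tnth => j.
rewrite !tnth_mktuple nth_replies //.
by case: j => j /=; case: k => [|[|k]] //; rewrite !subSS subn0 => /ltnW.
Qed.

(* X_1 = d . Y_1 + A_1 *)
Lemma alice1 f d r a : alice f d r a 1 = dotb d (bob f d r a 1) + a 1.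
Proof. by rewrite -message_replies. Qed.

(* X_k = Y_k * A_(k-1) + A_k for k >= 2 *)
Lemma aliceS f d r a k : (2 <= k)%N ->
  alice f d r a k = bob f d r a k * a k.-1 + a k.
Proof.
case: k => [|[|k]] // _; rewrite -message_replies /alice [in LHS]/=.
by rewrite nth_rcons size_rcons size_replies ltnn eqxx.
Qed.

End Protocol.

Section Probability.
Context {disp : measure_display} {Omega : measurableType disp} {R : realType}.
Variable P : probability Omega R.

(* Random variables with values in a finite type, which carries the discrete
   sigma-algebra. *)
Definition finite_rv (U : finType) (X : Omega -> U) : Prop :=
  forall E : set U, measurable (X @^-1` E).

Definition law (U : finType) (X : Omega -> U) : set U -> \bar R :=
  fun E => P (X @^-1` E).

Definition uniform_rv (U : finType) (X : Omega -> U) : Prop :=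
  forall u : U, law X [set u] = (#|U|%:R^-1)%:E.

(* Mutual independence of RB, A_1, ..., A_m. Subfamilies need not be listed:
   take the full set for the events to be left out. *)
Definition mutually_independent (T U : finType) (m : nat)
    (RB : Omega -> T) (A : nat -> Omega -> U) : Prop :=
  forall (S : set T) (B : nat -> set U),
    P (RB @^-1` S `&`
       \bigcap_(k in [set k | (1 <= k <= m)%N]) (A k @^-1` B k)) =
    (law RB S * \prod_(1 <= k < m.+1) law (A k) (B k))%E.

End Probability.

(* Main.v *)
(* Once Bob's randomness is fixed, Bob's message Y_k is a function of Alice's
   replies, so A_k = X_k - Y_k * A_(k-1) (and A_1 = X_1 - d . Y_1) recovers
   Alice's secrets from her replies. Hence every value (r, x) of the view comes
   from exactly one tuple of secrets and has probability P(R_B = r) / |F|^m,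
   whatever d is. *)
Require Import Defs.
From HB Require Import structures.
From mathcomp Require Import all_boot all_order all_algebra.
From mathcomp Require Import all_classical all_reals all_analysis.
From mathcomp Require Import zify.

Set Implicit Arguments.
Unset Strict Implicit.
Unset Printing Implicit Defensive.

Import Order.TTheory GRing.Theory Num.Theory.
Local Open Scope classical_set_scope.
Local Open Scope ring_scope.

(** Solves the reply equations for Alice's strings along a prescribed transcript [x], indexed from
    1. Bob's message is computed from [x] itself, so no actual secret enters. *)
Fixpoint secrets (F : finFieldType) (T : finType) (f : strategy F T) (d : bool)
    (r : T) (x : nat -> F) (k : nat) : F :=
  if k is i.+1 then
    let y := f i.+1 r [tuple x j.+1 | j < i.+1 - 2] in
    x i.+1 - (if i is 0 then dotb d y else y * secrets f d r x i)
  else 0.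

(** The system is triangular: once the earlier replies agree with [x], Bob's next message is fixed,
    and the next reply is a translate of the next secret. Nothing is divided by Bob's message, so it
    may be zero. *)
Lemma alice_eqP (F : finFieldType) (T : finType) (f : strategy F T) (d : bool)
    (r : T) (a x : nat -> F) (m : nat) :
  (forall k, (1 <= k <= m)%N -> alice f d r a k = x k) <->
  (forall k, (1 <= k <= m)%N -> a k = secrets f d r x k).
Proof.
elim: m => [|m IH]; first by split=> _ [|k].
(* Either direction may assume both prefix conditions, since the induction hypothesis turns each
   into the other. *)
suff step : (forall k, (1 <= k <= m)%N -> alice f d r a k = x k) ->
    (forall k, (1 <= k <= m)%N -> a k = secrets f d r x k) ->
    (alice f d r a m.+1 = x m.+1 <-> a m.+1 = secrets f d r x m.+1).
  have restrict (Q : nat -> Prop) : (forall k, (1 <= k <= m.+1)%N -> Q k) ->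
      forall k, (1 <= k <= m)%N -> Q k.
    by move=> h k /andP[k0 km]; apply: h; rewrite k0 leqW.
  split=> h k /andP[k0]; have hm := restrict _ h;
    rewrite leq_eqVlt => /orP[/eqP ->|km].
  - by apply/(step hm (IH.1 hm))/h; rewrite leqnn.
  - by apply: (IH.1 hm); rewrite k0.
  - by apply/(step (IH.2 hm) hm)/h; rewrite leqnn.
  - by apply: (IH.2 hm); rewrite k0.
move=> hx ha.
have hy : bob f d r a m.+1 = f m.+1 r [tuple x j.+1 | j < m.+1 - 2].
  congr (f _ r _); apply: eq_from_tnth => j; rewrite !tnth_mktuple hx //.
  (* Causality: the message in round [m.+1] uses replies up to round [m - 1] only, all covered by
     [hx]. *)
  by case: j => j /= jm; lia.
have -> : alice f d r a m.+1 = x m.+1 - secrets f d r x m.+1 + a m.+1.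
  rewrite /= subKr -hy; case: m {IH hx} ha hy => [|m] ha hy.
    exact: alice1.
  by rewrite aliceS // -ha // leqnn.
split=> [/eqP|->]; last by rewrite subrK.
by rewrite -addrA -[eqbRHS]addr0 (inj_eq (addrI _)) addrC subr_eq0 => /eqP.
Qed.

(** Puts the event in the product form required by [mutually_independent]: with [u] fixed, the
    prescribed secrets are constants. *)
Lemma preimage_view (F : finFieldType) (T : finType) (Omega : Type)
    (f : strategy F T) (m : nat) (d : bool) (RB : Omega -> T)
    (A : nat -> Omega -> F) (u : T * m.-tuple F) :
  (fun w => view f m d (RB w) (fun k => A k w)) @^-1` [set u] =
  RB @^-1` [set u.1] `&` \bigcap_(k in [set k | (1 <= k <= m)%N])
    A k @^-1` [set secrets f d u.1 (fun j => u.2`_j.-1) k].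
Proof.
case: u => r x; apply/seteqP; split => w /=.
  case=> <- hx; split=> //.
  apply: (alice_eqP f d (RB w) (A^~ w) (fun j => x`_j.-1) m).1.
  move=> [|k] //= km; rewrite -hx (nth_map (Ordinal km)) ?size_enum_ord //.
  by rewrite nth_enum_ord.
case=> <- /(alice_eqP f d (RB w) (A^~ w) (fun j => x`_j.-1) m).2 hx.
congr pair.
apply: eq_from_tnth => j; rewrite tnth_mktuple hx /= ?ltn_ord //.
by rewrite (tnth_nth 0).
Qed.

(** Every event is a finite disjoint union of fibres over points, so additivity applies. *)
Lemma law_set1_ext (disp : measure_display) (Omega : measurableType disp)
    (R : realType) (P : probability Omega R) (U : finType) (X Y : Omega -> U) :
  (forall u, measurable (X @^-1` [set u])) ->
  (forall u, measurable (Y @^-1` [set u])) ->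
  (forall u, law P X [set u] = law P Y [set u]) -> law P X = law P Y.
Proof.
move=> mX mY XY; apply/funext => E.
have lawE (Z : Omega -> U) : (forall u, measurable (Z @^-1` [set u])) ->
    law P Z E = \sum_(u \in E) law P Z [set u].
  move=> mZ; rewrite /law.
  have -> : Z @^-1` E = \bigcup_(u in E) Z @^-1` [set u].
    by apply/seteqP; split => w /= => [Ew|[u Eu /= ->]] //; exists (Z w).
  rewrite measure_fin_bigcup //.
    exact: finite_finset.
  by move=> u v _ _ [w [/= -> ->]].
by rewrite !lawE //; apply: eq_fsbigr => u _.
Qed.

Theorem proposition6p1 (m n : nat) (F : finFieldType) (T : finType)
  (disp : measure_display) (Omega : measurableType disp) (R : realType)
  (P : probability Omega R)
  (RB : Omega -> T) (A : nat -> Omega -> F) (f : strategy F T)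
  (hm : (1 <= m)%N) (hn : (1 <= n)%N) (hF : #|F| = (2 ^ n)%N)
  (hRB : finite_rv RB)
  (hA : forall k, (1 <= k <= m)%N -> finite_rv (A k))
  (hAunif : forall k, (1 <= k <= m)%N -> uniform_rv P (A k))
  (hindep : mutually_independent P m RB A) :
  law P (fun w => view f m false (RB w) (fun k => A k w)) =
  law P (fun w => view f m true (RB w) (fun k => A k w)).
Proof.
have mview d u :
    measurable ((fun w => view f m d (RB w) (fun k => A k w)) @^-1` [set u]).
  rewrite preimage_view; apply: measurableI; first exact: hRB.
  apply: fin_bigcap_measurable => [|k km]; last exact: hA.
  by apply: (sub_finite_set _ (finite_II m.+1)) => k /= /andP[].
(* The bit [d] affects only which value each [A k] must take, and uniformity gives all values the
   same probability. *)
have law1 d u :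
    law P (fun w => view f m d (RB w) (fun k => A k w)) [set u] =
    (law P RB [set u.1] * \prod_(1 <= k < m.+1) (#|F|%:R^-1)%:E)%E.
  rewrite /law preimage_view hindep; congr (_ * _)%E.
  by apply: eq_big_nat => k km; exact: hAunif.
by apply: law_set1_ext => // u; rewrite !law1.
Qed.
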